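(* Let $n_1,n_2,n^*_1,n^*_2$ be integers with $1\le n_1\le n^*_1\le n^*_2\le n_2$, $n=n_1+n_2$, $n^*=n^*_1+n^*_2$. Let $X_1,\dots,X_n$ be dependent nonnegative random variables sharing an Archimedean copula with generator $\psi_1$ ($\phi_1=\psi_1^{-1}$), with $X_i\sim F_1(\lambda_1x)$ for $i=1,\dots,n_1$ and $X_j\sim F_2(\lambda_2x)$ for $j=n_1+1,\dots,n$. Let $Y_1,\dots,Y_{n^*}$ be dependent nonnegative random variables sharing an Archimedean copula with generator $\psi_2$ ($\phi_2=\psi_2^{-1}$), with $Y_i\sim F_1(\mu_1x)$ for $i=1,\dots,n^*_1$ and $Y_j\sim F_2(\mu_2x)$ for $j=n^*_1+1,\dots,n^*$. Let $X_{n:n}(n_1,n_2)=\max_iX_i$ and $Y_{n^*:n^*}(n^*_1,n^*_2)=\max_iY_i$. Assume $\tilde r_1(x)\le\tilde r_2(x)$ for all $x>0$, $(n_1,n_2)\succeq_w(n^*_1,n^*_2)$, $\boldsymbol\lambda=(\lambda_1,\lambda_2),\boldsymbol\mu=(\mu_1,\mu_2)\in\mathcal D_+$, $\phi_2\circ\psi_1$ is super-additive, $\psi_1$ or $\psi_2$ is log-convex, and $\tilde r_1$ or $\tilde r_2$ is decreasing. Then $$(\underbrace{\lambda_1,\dots,\lambda_1}_{n^*_1},\underbrace{\lambda_2,\dots,\lambda_2}_{n^*_2})\succeq^{w}(\underbrace{\mu_1,\dots,\mu_1}_{n^*_1},\underbrace{\mu_2,\dots,\mu_2}_{n^*_2})\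 \Longrightarrow\ Y_{n^*:n^*}(n^*_1,n^*_2)\le_{st}X_{n:n}(n_1,n_2).$$
   Context: $Z\sim F(\lambda x)$ means $Z$ has distribution function $x\mapsto F(\lambda x)$. Archimedean copula: a generator is a continuous nonincreasing $\psi:[0,\infty)\to[0,1]$ with $\psi(0)=1$, $\psi(\infty)=0$, which is $m$-monotone; $\phi=\psi^{-1}$; $Z_1,\dots,Z_m$ with marginal distribution functions $G_i$ share an Archimedean copula with generator $\psi$ if $P(Z_1\le z_1,\dots,Z_m\le z_m)=\psi(\sum_i\phi(G_i(z_i)))$. $F_1,F_2$ are absolutely continuous baseline distribution functions on $[0,\infty)$ with densities $f_1,f_2$; $\tilde r_k=f_k/F_k$. Super-additive: $g(x)+g(y)\le g(x+y)$. $\mathcal D_+=\{(x_1,x_2):x_1\ge x_2>0\}$. For $\boldsymbol a,\boldsymbol b\in\mathbb R^k$ with increasingly ordered coordinates $a_{(1)}\le\dots\le a_{(k)}$: $\boldsymbol a\succeq^w\boldsymbol b$ means $\sum_{i=1}^l b_{(i)}\ge\sum_{i=1}^la_{(i)}$ for all $l$; $\boldsymbol a\succeq_w\boldsymbol b$ means $\sum_{i=l}^k a_{(i)}\ge\sum_{i=l}^kb_{(i)}$ for all $l$. $U\le_{st}V$ means $P(U>x)\le P(V>x)$ for all $x$. Increasing/decreasing are in the weak sense. *)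

(* Defs.v *)
From HB Require Import structures.
From mathcomp Require Import all_boot all_order all_algebra.
From mathcomp Require Import all_classical all_reals all_analysis.
Set Implicit Arguments. Unset Strict Implicit. Unset Printing Implicit Defensive.
Import Order.TTheory GRing.Theory Num.Theory.
Import numFieldNormedType.Exports.
Local Open Scope classical_set_scope.
Local Open Scope ring_scope.

Section Defs.
Variable R : realType.

Definition convex_on (A : set R) (f : R -> R) : Prop :=
  forall x y t, A x -> A y -> 0 <= t <= 1 ->
    f (t * x + (1 - t) * y) <= t * f x + (1 - t) * f y.

Definition log_convex_on (A : set R) (f : R -> R) : Prop :=
  forall x y t, A x -> A y -> 0 <= t <= 1 ->
    f (t * x + (1 - t) * y) <= (f x) `^ t * (f y) `^ (1 - t).

Definition nonincr_on (A : set R) (f : R -> R) : Prop :=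
  forall x y, A x -> A y -> x <= y -> f y <= f x.

(* m-monotonicity on [0,oo) (McNeil--Neslehova): psi continuous on [0,oo),
   differentiable on (0,oo) up to order m-2, (-1)^k psi^(k) >= 0 on (0,oo)
   for k = 0..m-2, and (-1)^(m-2) psi^(m-2) nonincreasing and convex on (0,oo). *)
Definition m_monotone (m : nat) (psi : R -> R) : Prop :=
  {within `[0, +oo[, continuous psi} /\
  (forall k : nat, (k < m - 2)%N -> forall x : R, 0 < x ->
      derivable (derive1n k psi) x 1) /\
  (forall k : nat, (k <= m - 2)%N -> forall x : R, 0 < x ->
      0 <= (-1) ^+ k * derive1n k psi x) /\
  nonincr_on `]0, +oo[ (fun x => (-1) ^+ (m - 2) * derive1n (m - 2) psi x) /\
  convex_on `]0, +oo[ (fun x => (-1) ^+ (m - 2) * derive1n (m - 2) psi x).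

Definition is_generator (m : nat) (psi : R -> R) : Prop :=
  psi 0 = 1 /\
  (forall x, 0 <= x -> 0 <= psi x <= 1) /\
  nonincr_on `[0, +oo[ psi /\
  {within `[0, +oo[, continuous psi} /\
  (psi x @[x --> +oo%R] --> (0 : R)) /\
  m_monotone m psi.

(* phi = psi^{-1}, the (generalized) inverse of the generator, with values in
   [0, +oo]: phi u = inf {x >= 0 | psi x <= u}  (phi 0 = +oo for strict psi). *)
Definition gen_inv (psi : R -> R) (u : R) : \bar R :=
  ereal_inf [set x%:E | x in [set x : R | 0 <= x /\ psi x <= u]].

Definition psi_ext (psi : R -> R) (e : \bar R) : R :=
  match e with
  | EFin r => psi r
  | +oo%E => 0
  | -oo%E => 1
  end.

(* phi2 o psi1 (as a [0,+oo]-valued map on [0,+oo)) *)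
Definition superadditive_on_nonneg (g : R -> \bar R) : Prop :=
  forall x y, 0 <= x -> 0 <= y -> (g x + g y <= g (x + y)%R)%E.

Definition baseline_cdf (F f : R -> R) : Prop :=
  {homo F : x y / x <= y} /\
  (forall x, x < 0 -> F x = 0) /\
  (F x @[x --> +oo%R] --> (1 : R)) /\
  (forall x, 0 <= f x) /\
  measurable_fun setT f /\
  (forall x, 0 <= x ->
     ((F x)%:E = \int[lebesgue_measure]_(t in `[0%R, x]%classic) (f t)%:E)%E).

Definition shares_arch_copula d (T : measurableType d) (P : probability T R)
    (m : nat) (Z : 'I_m -> {RV P >-> R}) (G : 'I_m -> R -> R)
    (psi : R -> R) : Prop :=
  is_generator m psi /\
  (forall i x, P [set w | Z i w <= x] = (G i x)%:E) /\
  (forall z : 'I_m -> R,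
     P [set w | forall i, Z i w <= z i] =
     (psi_ext psi (\sum_(i < m) gen_inv psi (G i (z i)))%E)%:E).

Definition incr (a : seq R) : seq R := sort <=%R a.

Definition wsubmaj (a b : seq R) : Prop :=
  size a = size b /\
  forall l : nat, (l <= size a)%N ->
    \sum_(i < l) nth 0 (incr a) i <= \sum_(i < l) nth 0 (incr b) i.

Definition wsupmaj (a b : seq R) : Prop :=
  size a = size b /\
  forall l : nat, (l < size a)%N ->
    \sum_(l <= i < size a) nth 0 (incr b) i <=
    \sum_(l <= i < size a) nth 0 (incr a) i.

Definition two_marg (k1 k : nat) (F1 F2 : R -> R) (l1 l2 : R) : 'I_k -> R -> R :=
  fun i x => if (i < k1)%N then F1 (l1 * x) else F2 (l2 * x).

Definition max_rv d (T : measurableType d) (P : probability T R) (k : nat)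
  (Z : 'I_k -> {RV P >-> R}) (w : T) : R := \big[Num.max/0]_(i < k) Z i w.

End Defs.

(* Main.v *)
Require Import Defs.
From HB Require Import structures.
From mathcomp Require Import all_boot all_order all_algebra.
From mathcomp Require Import all_classical all_reals all_analysis.
From mathcomp Require Import measurable_realfun ring lra.
Import Order.TTheory GRing.Theory Num.Theory.
Import numFieldNormedType.Exports.
Local Open Scope classical_set_scope.
Local Open Scope ring_scope.

(* For x > 0 put u_i = F_i(lambda_i x) and w_i = F_i(mu_i x).  Superadditivity of
   phi_2 o psi_1 gives psi_1(sum phi_1(u)) <= psi_2(sum phi_2(u)) for every finite
   family u, so it is enough to compare, for the log-convex generator psi,
   n_1 phi(u_1) + n_2 phi(u_2) with n*_1 phi(w_1) + n*_2 phi(w_2).  The block sizes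
   are exchanged using F_2 <= F_1, which follows from the order of the reversed
   hazard rates.  For the scale parameters the only nontrivial case is
   lambda_2 <= mu_2 <= mu_1 < lambda_1: the two intervals to be compared are then
   disjoint, phi o exp is convex, and a nonincreasing function m with r_1 <= m <= r_2
   (one of the two reversed hazard rates) bounds the increments of ln F_1 on the
   right interval from above and those of ln F_2 on the left one from below.
   Differential inequalities for ln F, which is only absolutely continuous, are
   replaced by increment bounds up to a quadratic error, summed over fine
   subdivisions. *)

(** * Monotonicity from increment bounds with a quadratic error *)

(** Over [N.+1] equal steps of width [d] the terms [(m a - m b) * d] telescope to [d * (m x - m z)]
    and the errors add up to [K * (z - x) * d]; both vanish as [N] grows. *)
Lemma nonincreasing_of_small_increments (R : realType) (x z K : R)
    (Phi m : R -> R) : x <= z -> 0 <= K ->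
  (forall a b, x <= a -> a <= b -> b <= z ->
     Phi b - Phi a <= (m a - m b) * (b - a) + K * (b - a) ^+ 2) ->
  Phi z <= Phi x.
Proof.
move=> xz K0 H; set W := z - x.
have W0 : 0 <= W by rewrite subr_ge0.
pose D := W * (m x - m z) + K * W ^+ 2.
have step (N : nat) : (Phi z - Phi x) * N.+1%:R <= D.
  pose d := W / N.+1%:R.
  have N0 : 0 < N.+1%:R :> R by rewrite ltr0n.
  have d0 : 0 <= d by rewrite divr_ge0 // ltW.
  have dW : d * N.+1%:R = W by rewrite /d mulfVK // gt_eqF.
  have in_range (k : nat) : (k <= N.+1)%N -> x + d * k%:R <= z.
    move=> kN; have : d * k%:R <= W by rewrite -dW ler_wpM2l // ler_nat.
    by rewrite /W; lra.
  have ind (k : nat) : (k <= N.+1)%N ->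
      Phi (x + d * k%:R) - Phi x
        <= d * (m x - m (x + d * k%:R)) + k%:R * (K * d ^+ 2).
    elim: k => [_|k IH kN]; first by rewrite mulr0 addr0 !subrr mulr0 mul0r addr0.
    have {}IH := IH (ltnW kN).
    have k0 : 0 <= d * k%:R by rewrite mulr_ge0.
    have := H (x + d * k%:R) (x + d * k.+1%:R) _ _ (in_range _ kN).
    rewrite -natr1 mulrDr mulr1 => /(_ ltac:(lra) ltac:(lra)).
    rewrite (_ : x + (d * k%:R + d) - (x + d * k%:R) = d); last by ring.
    by nra.
  have := ind N.+1 (leqnn _); rewrite dW (_ : x + W = z); last by rewrite /W; ring.
  move=> h; have {h} := ler_wpM2r (ltW N0) h.
  move/le_trans; apply.
  by rewrite /D -dW le_eqVlt; apply/orP; left; apply/eqP; ring.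
rewrite leNgt; apply/negP => lt.
have P0 : 0 < Phi z - Phi x by lra.
(* This number of steps exceeds [|D| / (Phi z - Phi x)], which contradicts [step]. *)
have := step (Num.bound (`|D| / (Phi z - Phi x))).
have := archi_boundP (divr_ge0 (normr_ge0 D) (ltW P0)).
rewrite ltr_pdivrMr // -natr1 => h1 h2.
have := ler_norm D; nra.
Qed.

(** * Increments of a baseline and of its logarithm *)

Section Baseline.
Variables (R : realType) (F f : R -> R).
Hypothesis bF : baseline_cdf F f.

Lemma baseline_le1 x : F x <= 1.
Proof.
case: bF => hom [_ [lim _]].
rewrite -(cvg_lim _ lim) //; apply: limr_ge; first by apply/cvg_ex; exists 1.
by exists x; split; rewrite ?num_real // => y /ltW /hom.
Qed.

Lemma baseline_at0 : F 0 = 0.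
Proof.
case: bF => _ [_ [_ [_ [_ intF]]]].
by apply: EFin_inj; rewrite intF // set_itv1 integral_set1.
Qed.

Lemma baseline_eventually_gt c : c < 1 -> exists2 z, 0 < z & c < F z.
Proof.
move=> c1; case: bF => _ [_ [lim _]].
have [M [_ MP]] := cvgr_gt 1 lim c c1.
exists (Num.max 0 M + 1); first by rewrite ltr_wpDl // le_max lexx.
by apply: MP; rewrite ltr_pwDr // le_max lexx orbT.
Qed.

Lemma baseline_increment a b : 0 <= a -> a <= b ->
  ((F b - F a)%:E = \int[lebesgue_measure]_(t in `]a, b]%classic) (f t)%:E)%E.
Proof.
move=> a0 ab; case: bF => _ [_ [_ [f0 [mf intF]]]].
have := intF b (le_trans a0 ab).
rewrite (@itv_bndbnd_setU _ _ _ (BRight a)) ?bnd_simp //.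
rewrite ge0_integral_setU //=; last 3 first.
- by apply/measurable_EFinP; apply: measurable_funTS.
- by move=> x _; rewrite lee_fin.
- apply/disj_setPS => y /= []; rewrite !in_itv /= => /andP[_ ya] /andP[ay _].
  by move: (le_lt_trans ya ay); rewrite ltxx.
rewrite -intF // => h.
by rewrite EFinB h addeAC subee // add0e.
Qed.

Lemma baseline_increment_le C a b : 0 <= a -> a <= b ->
  (forall t, a < t -> t <= b -> f t <= C) -> F b - F a <= C * (b - a).
Proof.
move=> a0 ab fC; case: (bF) => _ [_ [_ [f0 [mf _]]]].
have [->|ltab] := eqVneq a b; first by rewrite !subrr mulr0.
have {}ltab : a < b by rewrite lt_neqAle ltab.
have C0 : 0 <= C := le_trans (f0 b) (fC b ltab (lexx _)).
rewrite -lee_fin baseline_increment //.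
have -> : (C * (b - a))%:E
    = (\int[lebesgue_measure]_(t in `]a, b]%classic) (cst C%:E) t)%E.
  by rewrite integral_cst //= lebesgue_measure_itv /= lte_fin ltab.
apply: ge0_le_integral => //.
- by move=> x _; rewrite lee_fin.
- by apply/measurable_EFinP; apply: measurable_funTS.
- by move=> x /=; rewrite in_itv /= lee_fin => /andP[]; apply: fC.
Qed.

Lemma baseline_increment_ge C a b : 0 <= a -> a <= b -> 0 <= C ->
  (forall t, a < t -> t <= b -> C <= f t) -> C * (b - a) <= F b - F a.
Proof.
move=> a0 ab C0 fC; case: (bF) => _ [_ [_ [f0 [mf _]]]].
have [->|ltab] := eqVneq a b; first by rewrite !subrr mulr0.
have {}ltab : a < b by rewrite lt_neqAle ltab.
rewrite -lee_fin baseline_increment //.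
have -> : (C * (b - a))%:E
    = (\int[lebesgue_measure]_(t in `]a, b]%classic) (cst C%:E) t)%E.
  by rewrite integral_cst //= lebesgue_measure_itv /= lte_fin ltab.
apply: ge0_le_integral => //.
- by apply/measurable_EFinP; apply: measurable_funTS.
- by move=> x /=; rewrite in_itv /= lee_fin => /andP[]; apply: fC.
Qed.

Lemma baseline_continuous b : 0 <= b -> {within `[0, b], continuous F}.
Proof.
move=> b0; case: (bF) => hom [_ [_ [f0 [mf intF]]]].
have If : lebesgue_measure.-integrable `[0, b] (EFin \o f).
  apply/integrableP; split; first by apply/measurable_EFinP; apply: measurable_funTS.
  rewrite (_ : integral _ _ _ = (F b)%:E) ?ltry // intF //.
  by apply: eq_integral => x _; rewrite /= ger0_norm.
have := parameterized_integral_continuous b0 If.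
apply: subspace_eq_continuous => x; rewrite inE /= in_itv /= => /andP[x0 _].
by apply: EFin_inj; rewrite intF // /parameterized_integral /Rintegral fineK // -intF.
Qed.

(** On the interval [f <= C F <= C F b], so [ln q <= q - 1] with [q = F b / F a] gives the slope [C]
    up to the factor [q]; as [F b <= F a + C (b - a)], this factor costs only the quadratic term.
    The base point [x] makes the error constant common to all subintervals. *)
Lemma ln_increment_le C x a b : 0 <= x -> x <= a -> a <= b -> 0 < F x -> 0 <= C ->
  (forall t, a < t -> t <= b -> f t / F t <= C) ->
  ln (F b) - ln (F a) <= C * (b - a) + C ^+ 2 / F x * (b - a) ^+ 2.
Proof.
move=> x0 xa ab Fx C0 H; case: (bF) => hom _.
have Fxa : F x <= F a := hom _ _ xa.
have Fab : F a <= F b := hom _ _ ab.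
have Fb1 := baseline_le1 b.
have Fa : 0 < F a by lra.
have Fb : 0 < F b by lra.
have d0 : 0 <= b - a by lra.
have inc : F b - F a <= (C * F b) * (b - a).
  apply: baseline_increment_le => //; first lra.
  move=> t at' tb; have Fat : F a <= F t := hom _ _ (ltW at').
  have Ftb : F t <= F b := hom _ _ tb.
  have := H t at' tb; rewrite ler_pdivrMr; last lra.
  by move=> h; nra.
rewrite -ln_div ?posrE //.
set q := F b / F a.
have q0 : 0 < q by rewrite divr_gt0.
have lnq : ln q <= q - 1.
  have := @le_ln1Dx R (q - 1); rewrite addrCA subrr addr0; apply; lra.
apply: le_trans lnq _.
have qE : q * F a = F b by rewrite /q mulfVK // gt_eqF.
set y := C ^+ 2 / F x.
have y0 : 0 <= y by rewrite divr_ge0 ?sqr_ge0 // ltW.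
have yE : y * F x = C ^+ 2 by rewrite /y mulfVK // gt_eqF.
rewrite -(ler_pM2r Fa) mulrDl mulN1r qE.
apply: (le_trans inc).
set d := b - a in d0 *.
have Cd0 : 0 <= C * d by rewrite mulr_ge0.
have h1 : F b <= F a + C * d.
  have : C * d * F b <= C * d * 1 by rewrite ler_wpM2l.
  move: inc; rewrite -/d; lra.
have h2 : y * d ^+ 2 * F x <= y * d ^+ 2 * F a.
  by rewrite ler_wpM2l // mulr_ge0 // sqr_ge0.
have h3 : y * d ^+ 2 * F x = (C * d) ^+ 2 by rewrite mulrAC yE; ring.
have -> : (C * d + y * d ^+ 2) * F a = C * d * F a + y * d ^+ 2 * F a by ring.
have : C * F b * d <= C * d * (F a + C * d).
  by rewrite mulrAC ler_wpM2l.
have -> : C * d * (F a + C * d) = C * d * F a + (C * d) ^+ 2 by ring.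
lra.
Qed.

(** Here [q = F a / F b]. With [u = C (b - a)] one gets [u q <= 1 - q], hence
    [1 - q >= u / (1 + u) >= u - u^2]. *)
Lemma ln_increment_ge C a b : 0 <= a -> a <= b -> 0 < F a -> 0 <= C ->
  (forall t, a < t -> t <= b -> C <= f t / F t) ->
  C * (b - a) - C ^+ 2 * (b - a) ^+ 2 <= ln (F b) - ln (F a).
Proof.
move=> a0 ab Fa C0 H; case: (bF) => hom _.
have Fab : F a <= F b := hom _ _ ab.
have Fb : 0 < F b by lra.
have d0 : 0 <= b - a by lra.
have inc : (C * F a) * (b - a) <= F b - F a.
  apply: baseline_increment_ge => //; first by rewrite mulr_ge0 // ltW.
  move=> t at' tb; have Fat : F a <= F t := hom _ _ (ltW at').
  have := H t at' tb; rewrite ler_pdivlMr; last lra.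
  by apply: le_trans; rewrite ler_wpM2l.
have -> : ln (F b) - ln (F a) = - ln (F a / F b) by rewrite ln_div ?posrE //; ring.
set q := F a / F b.
have q0 : 0 < q by rewrite divr_gt0.
have lnq : ln q <= q - 1.
  have := @le_ln1Dx R (q - 1); rewrite addrCA subrr addr0; apply; lra.
suff : C * (b - a) - C ^+ 2 * (b - a) ^+ 2 <= 1 - q by lra.
have qE : q * F b = F a by rewrite /q mulfVK // gt_eqF.
set d := b - a in d0 inc *.
have Cd0 : 0 <= C * d by rewrite mulr_ge0.
have h : C * d * q <= 1 - q.
  rewrite -(ler_pM2r Fb).
  have -> : C * d * q * F b = C * F a * d by rewrite -qE; ring.
  by rewrite mulrBl mul1r qE.
have -> : C ^+ 2 * d ^+ 2 = (C * d) ^+ 2 by ring.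
set u := C * d in Cd0 h *; nra.
Qed.

End Baseline.

(** * Reversed hazard rates *)

Section BaselineBounds.
Variables (R : realType) (F f : R -> R).
Hypothesis bF : baseline_cdf F f.

Lemma baseline_ge0 x : 0 <= F x.
Proof.
case: (bF) => hom [Fneg _]; have [x0|x0] := ltP x 0; first by rewrite Fneg.
by rewrite -(baseline_at0 _ _ _ bF); apply: hom.
Qed.

Lemma rev_hazard_ge0 x : 0 <= f x / F x.
Proof. by case: (bF) => _ [_ [_ [f0 _]]]; rewrite divr_ge0 // baseline_ge0. Qed.

(** Subdivision removes the quadratic error: with a constant [m] only that error has to be
    summed. *)
Lemma ln_baseline_le C a b : 0 <= a -> a <= b -> 0 < F a -> 0 <= C ->
  (forall t, a < t -> t <= b -> f t / F t <= C) ->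
  ln (F b) - ln (F a) <= C * (b - a).
Proof.
move=> a0 ab Fa C0 H.
suff : ln (F b) - C * b <= ln (F a) - C * a by lra.
apply: (@nonincreasing_of_small_increments R a b (C ^+ 2 / F a)
  (fun t => ln (F t) - C * t) (cst 0)) => //.
  by rewrite divr_ge0 ?sqr_ge0 // ltW.
move=> s t as_ st tb /=; rewrite subrr mul0r add0r.
suff : ln (F t) - ln (F s) <= C * (t - s) + C ^+ 2 / F a * (t - s) ^+ 2 by lra.
apply: (ln_increment_le _ _ _ bF) => // u su ut; apply: H; lra.
Qed.

Lemma ln_baseline_ge C a b : 0 <= a -> a <= b -> 0 < F a -> 0 <= C ->
  (forall t, a < t -> t <= b -> C <= f t / F t) ->
  C * (b - a) <= ln (F b) - ln (F a).
Proof.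
move=> a0 ab Fa C0 H.
suff : C * b - ln (F b) <= C * a - ln (F a) by lra.
apply: (@nonincreasing_of_small_increments R a b (C ^+ 2)
  (fun t => C * t - ln (F t)) (cst 0)) => //.
  by rewrite sqr_ge0.
move=> s t as_ st tb /=; rewrite subrr mul0r add0r.
suff : C * (t - s) - C ^+ 2 * (t - s) ^+ 2 <= ln (F t) - ln (F s) by lra.
apply: (ln_increment_ge _ _ _ bF) => //; first by lra.
- by case: (bF) => hom _; apply: (lt_le_trans Fa); apply: hom.
- by move=> u su ut; apply: H; lra.
Qed.

(* If [F] vanished at [y], then [ln F] would be unbounded below on [`]y, z]],
   although it has bounded slope there. *)
Lemma baseline_gt0_of_bounded_rev_hazard C y z : 0 <= y -> y <= z -> 0 <= C ->
  0 < F z -> (forall t, y < t -> t <= z -> f t / F t <= C) -> 0 < F y.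
Proof.
move=> y0 yz C0 Fz H.
rewrite lt_neqAle baseline_ge0 andbT; apply/eqP => Fy.
(* This value makes [ln (F z) - ln e] equal to [C (z - y) + 1], one more than a slope of at most [C]
   permits between [y] and [z]. *)
pose e := F z * expR (- (C * (z - y)) - 1).
have Czy : 0 <= C * (z - y) by rewrite mulr_ge0 // subr_ge0.
have e0 : 0 < e by rewrite mulr_gt0 // expR_gt0.
have ez : e <= F z.
  by rewrite ler_piMr ?(ltW Fz) // expR_le1; lra.
have ctsF : {within `[y, z], continuous F}.
  apply: (continuous_subspaceW _ (baseline_continuous _ _ _ bF z (le_trans y0 yz))).
  by apply: subset_itvr; rewrite bnd_simp.
have [|s] := IVT yz ctsF (v := e).
  by rewrite -Fy (min_idPl (ltW Fz)) (max_idPr (ltW Fz)) (ltW e0) ez.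
rewrite in_itv /= => /andP[ys sz] Fs.
have := ln_baseline_le C s z (le_trans y0 ys) sz; rewrite Fs => /(_ e0 C0).
have -> : ln e = ln (F z) + (- (C * (z - y)) - 1).
  by rewrite lnM ?posrE ?expR_gt0 // expRK.
have : C * (z - s) <= C * (z - y) by rewrite ler_wpM2l //; lra.
move=> h1 h2; suff /h2 : forall t, s < t -> t <= z -> f t / F t <= C by lra.
by move=> t st tz; apply: H => //; apply: le_lt_trans st.
Qed.

(** The rate at [y] bounds all later ones, and [F] is positive far out, so positivity propagates
    back to [y]. *)
Lemma baseline_gt0_of_nonincr_rev_hazard :
  nonincr_on `]0, +oo[ (fun x => f x / F x) -> forall y, 0 < y -> 0 < F y.
Proof.
move=> dec y y0; case: (bF) => hom _.
have [z z0 Fz] := baseline_eventually_gt _ _ _ bF 0 ltr01.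
have [zy|yz] := leP z y; first exact: (lt_le_trans Fz (hom _ _ zy)).
apply: (@baseline_gt0_of_bounded_rev_hazard (f y / F y) y z) => //.
- exact: ltW.
- exact: ltW.
- exact: rev_hazard_ge0.
- move=> t yt _; apply: dec; rewrite /= ?in_itv /= ?andbT //; last exact: ltW.
  exact: lt_trans yt.
Qed.

End BaselineBounds.

(** * Separation of the reversed hazard rates and order of the baselines *)

Section Comparison.
Variables (R : realType) (F1 f1 F2 f2 : R -> R).
Hypothesis bF1 : baseline_cdf F1 f1.
Hypothesis bF2 : baseline_cdf F2 f2.

(** The separator [m] stands for whichever rate is decreasing, so that both alternatives are treated
    at once. Positivity is included to make the logarithms meaningful. *)
Definition rev_hazards_separated (m : R -> R) :=
  [/\ {in Num.pos &, {homo m : x y /~ x <= y}},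
      forall x, 0 < x -> f1 x / F1 x <= m x <= f2 x / F2 x,
      forall x, 0 < x -> 0 < F1 x & forall x, 0 < x -> 0 < F2 x].

(* The convention [f / 0 = 0] makes a nonincreasing reversed hazard rate
   incompatible with a baseline that vanishes near [0]. *)
Lemma ex_rev_hazards_separated :
  (forall x, 0 < x -> f1 x / F1 x <= f2 x / F2 x) ->
  (nonincr_on `]0, +oo[ (fun x => f1 x / F1 x) \/
   nonincr_on `]0, +oo[ (fun x => f2 x / F2 x)) ->
  exists m, rev_hazards_separated m.
Proof.
move=> r12 [dec|dec].
- have F1pos := baseline_gt0_of_nonincr_rev_hazard _ _ _ bF1 dec.
  exists (fun x => f1 x / F1 x); split=> //.
  + by move=> x y; rewrite !posrE => x0 y0 xy; apply: dec; rewrite //= in_itv /= andbT.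
  + by move=> x x0; rewrite lexx r12.
  + move=> y y0; rewrite lt_neqAle (baseline_ge0 _ _ _ bF2) andbT.
    apply/eqP => F2y.
    (* If [F2 y = 0], then [F2] vanishes on all of []0, y]], where the second rate is 0 by
       convention; the first rate, hence [f1], is then at most 0 there, which forces [F1 y = 0]. *)
    have : F1 y - F1 0 <= 0 * (y - 0).
      apply: (baseline_increment_le _ _ _ bF1) => // [|t t0 ty]; first exact: ltW.
      have F2t : F2 t = 0.
        apply/eqP; rewrite eq_le (baseline_ge0 _ _ _ bF2) andbT F2y.
        by case: (bF2) => hom _; apply: hom.
      by have := r12 _ t0; rewrite F2t invr0 mulr0 ler_pdivrMr ?mul0r // F1pos.
    by rewrite (baseline_at0 _ _ _ bF1) mul0r; have := F1pos _ y0; lra.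
- have F2pos := baseline_gt0_of_nonincr_rev_hazard _ _ _ bF2 dec.
  exists (fun x => f2 x / F2 x); split=> //.
  + by move=> x y; rewrite !posrE => x0 y0 xy; apply: dec; rewrite //= in_itv /= andbT.
  + by move=> x x0; rewrite lexx r12.
  + move=> y y0; have [z z0 F1z] := baseline_eventually_gt _ _ _ bF1 0 ltr01.
    have [zy|yz] := leP z y.
      by case: (bF1) => hom _; apply: (lt_le_trans F1z (hom _ _ zy)).
    apply: (@baseline_gt0_of_bounded_rev_hazard _ _ _ bF1 (f2 y / F2 y) y z) => //.
    * exact: ltW.
    * exact: ltW.
    * exact: (rev_hazard_ge0 _ _ _ bF2).
    * move=> t yt _; have t0 := lt_trans y0 yt.
      apply: (le_trans (r12 _ t0)); apply: dec; rewrite /= ?in_itv /= ?andbT //.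
      exact: ltW.
Qed.

Variable m : R -> R.
Hypothesis sep : rev_hazards_separated m.

Lemma separator_ge0 x : 0 < x -> 0 <= m x.
Proof.
case: sep => _ H _ _ x0; have /andP[h _] := H _ x0.
exact: le_trans (rev_hazard_ge0 _ _ _ bF1 x) h.
Qed.

(** [ln F1 - ln F2] has formal slope [r1 - r2 <= 0], so [F1 / F2] is nonincreasing. If it were below
    1 at [x], it would stay below that value, although [F1] tends to 1 and [F2 <= 1]. *)
Lemma baseline_order x : 0 < x -> F2 x <= F1 x.
Proof.
move=> x0; case: (sep) => dec r F1pos F2pos.
have ratio z : x <= z -> ln (F1 z) - ln (F2 z) <= ln (F1 x) - ln (F2 x).
  move=> xz; have mx := separator_ge0 _ x0.
  apply: (@nonincreasing_of_small_increments R x z (m x ^+ 2 / F1 x + m x ^+ 2)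
    (fun t => ln (F1 t) - ln (F2 t)) m) => //.
    by rewrite addr_ge0 ?sqr_ge0 // divr_ge0 ?sqr_ge0 // ltW // F1pos.
  move=> a b xa ab bz.
  have a0 : 0 < a by lra.
  have b0 : 0 < b by lra.
  have ma := separator_ge0 _ a0; have mb := separator_ge0 _ b0.
  have max : m a <= m x by apply: dec; rewrite ?posrE.
  have mba : m b <= m a by apply: dec; rewrite ?posrE.
  (* Monotonicity of [m] bounds the slope of [ln F1] by [m a] and that of [ln F2] from below by
     [m b]; the gap [m a - m b] is the telescoping term. *)
  have u1 : ln (F1 b) - ln (F1 a) <= m a * (b - a) + m a ^+ 2 / F1 x * (b - a) ^+ 2.
    apply: (ln_increment_le _ _ _ bF1) => //; [exact: ltW|exact: F1pos|].
    move=> t at_ tb; have t0 : 0 < t by lra.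
    have /andP[h _] := r _ t0; apply: (le_trans h).
    by apply: dec; rewrite ?posrE // ltW.
  have l2 : m b * (b - a) - m b ^+ 2 * (b - a) ^+ 2 <= ln (F2 b) - ln (F2 a).
    apply: (ln_increment_ge _ _ _ bF2) => //; [exact: ltW|exact: F2pos|].
    move=> t at_ tb; have t0 : 0 < t by lra.
    have /andP[_ h] := r _ t0; apply: le_trans h.
    by apply: dec; rewrite ?posrE.
  have sq c : 0 <= c -> c <= m x -> c ^+ 2 <= m x ^+ 2.
    by move=> c0 cx; rewrite ler_pXn2r // ?nnegrE.
  have d2 : 0 <= (b - a) ^+ 2 by rewrite sqr_ge0.
  have e1 : m a ^+ 2 / F1 x * (b - a) ^+ 2 <= m x ^+ 2 / F1 x * (b - a) ^+ 2.
    rewrite ler_wpM2r // ler_wpM2r ?invr_ge0 ?(ltW (F1pos _ x0)) //.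
    exact: sq.
  have e2 : m b ^+ 2 * (b - a) ^+ 2 <= m x ^+ 2 * (b - a) ^+ 2.
    by rewrite ler_wpM2r // sq // (le_trans mba).
  lra.
rewrite leNgt; apply/negP => lt.
have F1x := F1pos _ x0; have F2x := F2pos _ x0.
have c1 : F1 x / F2 x < 1 by rewrite ltr_pdivrMr // mul1r.
have [z0 z00 F1z0] := baseline_eventually_gt _ _ _ bF1 _ c1.
pose z := Num.max x z0.
have xz : x <= z by rewrite le_max lexx.
have {}F1z : F1 x / F2 x < F1 z.
  apply: (lt_le_trans F1z0); case: (bF1) => hom _; apply: hom.
  by rewrite le_max lexx orbT.
have z_pos : 0 < z := lt_le_trans x0 xz.
have := ratio z xz.
rewrite -!ln_div ?posrE ?F1pos ?F2pos // ler_ln ?posrE ?divr_gt0 ?F1pos ?F2pos //.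
apply/negP; rewrite -ltNge; apply: (lt_le_trans F1z).
rewrite ler_pdivlMr ?F2pos // ler_piMr ?(baseline_ge0 _ _ _ bF1) //.
exact: baseline_le1 bF2 _.
Qed.

End Comparison.

(** * Archimedean generators *)

Section Generator.
Variables (R : realType) (k : nat) (psi : R -> R).
Hypothesis gpsi : is_generator k psi.

Lemma generator_range x : 0 <= x -> 0 <= psi x <= 1.
Proof. by case: gpsi => _ [+ _]; apply. Qed.

Lemma generator_nonincr x y : 0 <= x -> x <= y -> psi y <= psi x.
Proof.
case: gpsi => _ [_ [+ _]] x0 xy.
by apply => //=; rewrite in_itv /= andbT // (le_trans x0).
Qed.

Lemma generator_IVT a b u : 0 <= a -> a <= b -> psi b <= u <= psi a ->
  exists2 c, a <= c <= b & psi c = u.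
Proof.
move=> a0 ab /andP[bu ua]; case: gpsi => _ [_ [_ [cts _]]].
have psi_ab := generator_nonincr _ _ a0 ab.
have [||c] := IVT ab (f := psi) (v := u).
- apply: continuous_subspaceW cts => x /=; rewrite !in_itv /= andbT.
  by case/andP=> + _; apply: le_trans.
- by rewrite (min_idPr psi_ab) (max_idPl psi_ab) bu ua.
- by rewrite in_itv /=; exists c.
Qed.

Lemma gen_inv_ge0 u : (0 <= gen_inv psi u)%E.
Proof. by apply: le_ereal_inf_tmp => _ [x [x0 _] <-]; rewrite lee_fin. Qed.

Lemma gen_inv_le x u : 0 <= x -> psi x <= u -> (gen_inv psi u <= x%:E)%E.
Proof. by move=> x0 xu; apply: ereal_inf_lbound; exists x. Qed.

(** For [u > 0] the infimum is finite because [psi] tends to 0, and attained because [psi] is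
    continuous. *)
Lemma gen_inv_spec u : 0 < u <= 1 ->
  exists s, [/\ 0 <= s, gen_inv psi u = s%:E & psi s = u].
Proof.
case/andP=> u0 u1; case: (gpsi) => psi0 [_ [_ [_ [lim0 _]]]].
have [s' s'0 psis'] : exists2 s', 0 <= s' & psi s' = u.
  have [M [_ MP]] := cvgr_lt _ lim0 _ u0.
  pose b := Num.max 0 M + 1.
  have b0 : 0 <= b by rewrite addr_ge0 // le_max lexx.
  have psib : psi b < u.
    by apply: MP; rewrite ltr_pwDr // le_max lexx orbT.
  have [|c /andP[c0 _] psic] := generator_IVT 0 b u (lexx _) b0.
    by rewrite psi0 u1 ltW.
  by exists c.
have ub := gen_inv_le s' u s'0 ltac:(by rewrite psis').
have := gen_inv_ge0 u; case E : (gen_inv psi u) ub => [s||] //.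
rewrite !lee_fin => ss' s0; exists s; split => //.
apply/eqP; rewrite eq_le -{2}psis' generator_nonincr // andbT leNgt.
apply/negP => us.
(* If [psi s > u], a point [c] with a value halfway between lies beyond [s] and still below every
   [x] with [psi x <= u], so [s] is not the infimum. *)
have [|c /andP[sc cs'] psic] := generator_IVT s s' ((psi s + u) / 2) s0 ss'.
  by rewrite psis'; apply/andP; split; lra.
suff : (c%:E <= gen_inv psi u)%E.
  rewrite E lee_fin => cs; have ces : c = s by apply/eqP; rewrite eq_le cs.
  by move: psic; rewrite ces; lra.
apply: le_ereal_inf_tmp => _ [x [x0 xu] <-]; rewrite lee_fin leNgt.
apply/negP => xc; have := generator_nonincr _ _ x0 (ltW xc); rewrite psic; lra.
Qed.

(** On []0, 1]] the inverse is finite and [fine] loses nothing; an infinite value is sent to 0. *)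
Definition phi (u : R) : R := fine (gen_inv psi u).

Lemma gen_invE u : 0 < u <= 1 -> gen_inv psi u = (phi u)%:E.
Proof. by case/gen_inv_spec => s [_ E _]; rewrite /phi E. Qed.

Lemma phi_ge0 u : 0 < u <= 1 -> 0 <= phi u.
Proof. by case/gen_inv_spec => s [s0 E _]; rewrite /phi E. Qed.

Lemma phiK u : 0 < u <= 1 -> psi (phi u) = u.
Proof. by case/gen_inv_spec => s [_ E]; rewrite /phi E. Qed.

Lemma phi_le s u : 0 < u <= 1 -> 0 <= s -> psi s <= u -> phi u <= s.
Proof. by move=> u01 s0 su; rewrite -lee_fin -gen_invE // gen_inv_le. Qed.

Lemma phi_nonincr u v : 0 < u -> u <= v -> v <= 1 -> phi v <= phi u.
Proof.
move=> u0 uv v1; have u01 : 0 < u <= 1 by rewrite u0 (le_trans uv).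
by apply: phi_le; rewrite ?phi_ge0 ?phiK // v1 (lt_le_trans u0).
Qed.

Hypothesis logconv : log_convex_on `[0, +oo[ psi.

(** This is convexity of [ln psi], multiplied by [c - a] so that the degenerate case [a = c] is
    included. *)
Lemma ln_generator_chord a b c : 0 <= a -> a <= b -> b <= c -> 0 < psi c ->
  (c - a) * ln (psi b) <= (c - b) * ln (psi a) + (b - a) * ln (psi c).
Proof.
move=> a0 ab bc psic.
have [ac|ac] := eqVneq a c.
  have <- : a = b by apply/eqP; rewrite eq_le ab ac bc.
  by rewrite -ac !subrr !mul0r addr0.
have {}ac : 0 < c - a by rewrite subr_gt0 lt_neqAle ac (le_trans ab).
pose t := (c - b) / (c - a).
have tE : t * (c - a) = c - b by rewrite /t mulfVK // gt_eqF.
have psib : 0 < psi b := lt_le_trans psic (generator_nonincr _ _ (le_trans a0 ab) bc).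
have psia : 0 < psi a := lt_le_trans psib (generator_nonincr _ _ a0 ab).
have t01 : 0 <= t <= 1.
  by rewrite divr_ge0 ?subr_ge0 //= ?ler_pdivrMr // ?mul1r; lra.
have := logconv a c t; rewrite /= !in_itv /= !andbT => /(_ a0 ltac:(lra) t01).
have -> : t * a + (1 - t) * c = b by have := tE; lra.
rewrite -ler_ln ?posrE ?mulr_gt0 ?powR_gt0 // lnM ?posrE ?powR_gt0 // !ln_powR => h.
have := ler_wpM2l (ltW ac) h.
have -> : (c - a) * (t * ln (psi a) + (1 - t) * ln (psi c))
  = (t * (c - a)) * ln (psi a) + ((c - a) - t * (c - a)) * ln (psi c) by ring.
by rewrite tE; lra.
Qed.

(* [phi \o expR] is convex, so the increment of [phi] over the leftmost pair
   dominates, relative to the increment of the logarithm. *)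
Lemma phi_weighted_sum_le p q v2 w2 w1 v1 : 0 < p -> 0 < q ->
  0 < v2 -> v2 <= w2 -> w2 <= w1 -> w1 <= v1 -> v1 <= 1 ->
  p * (ln v1 - ln w1) <= q * (ln w2 - ln v2) ->
  p * phi w1 + q * phi w2 <= p * phi v1 + q * phi v2.
Proof.
move=> p0 q0 v20 vw2 w21 wv1 v11 h.
have v2I : 0 < v2 <= 1 by lra.
have w2I : 0 < w2 <= 1 by lra.
have w1I : 0 < w1 <= 1 by lra.
have v1I : 0 < v1 <= 1 by lra.
have A1_0 := phi_ge0 _ v1I.
have le1 : phi v1 <= phi w1 by apply: phi_nonincr; lra.
have le2 : phi w1 <= phi w2 by apply: phi_nonincr; lra.
have le3 : phi w2 <= phi v2 by apply: phi_nonincr; lra.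
have c1 := @ln_generator_chord (phi v1) (phi w1) (phi v2) A1_0 le1 (le_trans le2 le3).
have c2 := @ln_generator_chord (phi v1) (phi w2) (phi v2) A1_0 (le_trans le1 le2) le3.
move: c1 c2; rewrite !phiK // => /(_ v20) c1 /(_ v20) c2.
have [wE|wN] := eqVneq w1 v1.
  by rewrite wE lerD2l ler_wpM2l // ltW.
have V0 : 0 < ln v1 - ln w1.
  have ltw1v1 : w1 < v1 by rewrite lt_neqAle wN.
  by rewrite subr_gt0 ltr_ln ?posrE //; lra.
set a1 := phi v1 in A1_0 le1 le2 le3 c1 c2 *; set b1 := phi w1 in le1 le2 le3 c1 c2 *.
set b2 := phi w2 in le1 le2 le3 c1 c2 *; set a2 := phi v2 in le1 le2 le3 c1 c2 *.
set V := ln v1 - ln w1 in h V0; set U := ln w2 - ln v2 in h.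
(* [S] is the drop of [ln psi] over [[a1, a2]]. Both inner points are compared with the same chord,
   and eliminating [S] relates the two end increments directly. *)
pose S := ln v1 - ln v2.
have hV : (b1 - a1) * S <= (a2 - a1) * V.
  by rewrite /S /V; lra.
have hU : (a2 - a1) * U <= (a2 - b2) * S.
  by rewrite /S /U; lra.
have U0 : 0 < U by rewrite -(pmulr_rgt0 _ q0); apply: lt_le_trans h; rewrite mulr_gt0.
have [aE|aN] := eqVneq a1 a2.
  have -> : b1 = a1 by lra.
  have -> : b2 = a2 by lra.
  by [].
have W0 : 0 < a2 - a1 by rewrite subr_gt0 lt_neqAle aN; lra.
have X0 : 0 <= a2 - b2 by lra.
have Y0 : 0 <= b1 - a1 by lra.
have VXUY : (b1 - a1) * U <= (a2 - b2) * V.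
  rewrite -(ler_pM2r W0).
  have := ler_wpM2l Y0 hU; have := ler_wpM2l X0 hV; lra.
suff : p * (b1 - a1) <= q * (a2 - b2) by lra.
rewrite -(ler_pM2r U0).
have := ler_wpM2l (ltW p0) VXUY; have := ler_wpM2l X0 h; lra.
Qed.

End Generator.
Arguments phi {R} psi u.

(** * Change of generator at fixed margins *)

Lemma superadditive_sum (R : realType) (g : R -> \bar R) (n : nat)
    (s : 'I_n -> R) : superadditive_on_nonneg g -> (0 <= g 0%R)%E ->
  (forall i, 0 <= s i) -> (\sum_(i < n) g (s i) <= g (\sum_(i < n) s i)%R)%E.
Proof.
move=> sup g0 s0.
suff [] : (\sum_(i < n) g (s i) <= g (\sum_(i < n) s i)%R)%E /\ 0 <= \sum_(i < n) s i.
  by [].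
elim/big_rec2 : _ => // i x y _ [IH y0]; split; last exact: addr_ge0.
by apply: le_trans (sup _ _ (s0 i) y0); apply: leeD.
Qed.

(** Super-additivity at the points [phi psi1 (u i)], which [psi1] sends to [u i], bounds the sum of
    the [phi psi2 (u i)] by the [psi2]-inverse of the left side; [psi2] reverses this. *)
Lemma arch_copula_order (R : realType) (k1 k2 n : nat) (psi1 psi2 : R -> R)
    (u : 'I_n -> R) :
  is_generator k1 psi1 -> is_generator k2 psi2 ->
  superadditive_on_nonneg (fun x => gen_inv psi2 (psi1 x)) ->
  (forall i, 0 < u i <= 1) ->
  psi1 (\sum_(i < n) phi psi1 (u i)) <= psi2 (\sum_(i < n) phi psi2 (u i)).
Proof.
move=> g1 g2 sup uI.
have S0 : 0 <= \sum_(i < n) phi psi1 (u i).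
  by apply: sumr_ge0 => i _; apply: phi_ge0 g1 _ (uI i).
have T0 : 0 <= \sum_(i < n) phi psi2 (u i).
  by apply: sumr_ge0 => i _; apply: phi_ge0 g2 _ (uI i).
have /andP[w0 w1] := generator_range _ _ _ g1 _ S0.
(* A left side equal to 0 is split off, since its [psi2]-inverse may be infinite; nonnegativity of
   [psi2] settles it. *)
move: w0; rewrite le_eqVlt => /predU1P[<-|w0].
  by case/andP: (generator_range _ _ _ g2 _ T0).
set w := psi1 _ in w0 w1 *.
have wI : 0 < w <= 1 by rewrite w0.
rewrite -[leLHS](phiK _ _ _ g2 _ wI); apply: (generator_nonincr _ _ _ g2) => //.
rewrite -lee_fin -(gen_invE _ _ _ g2 _ wI) -sumEFin.
have := superadditive_sum _ _ _ (fun i => phi psi1 (u i)) sup (gen_inv_ge0 _ _ _)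
  (fun i => phi_ge0 _ _ _ g1 _ (uI i)).
apply: le_trans; apply: lee_sum => i _.
by rewrite (phiK _ _ _ g1 _ (uI i)) (gen_invE _ _ _ g2 _ (uI i)).
Qed.

(** * Majorization and the maxima *)

(** Only the first and the last partial sums are kept: the smallest entries, which come from the
    nonempty second block, and the totals. *)
Lemma wsubmaj_blocks (R : realType) (p q : nat) (l1 l2 m1 m2 : R) :
  (0 < q)%N -> l2 <= l1 -> m2 <= m1 ->
  wsubmaj (nseq p l1 ++ nseq q l2) (nseq p m1 ++ nseq q m2) ->
  l2 <= m2 /\ p%:R * l1 + q%:R * l2 <= p%:R * m1 + q%:R * m2.
Proof.
move=> q0 l21 m21 [_ H].
have incrE (a b : R) : b <= a -> incr (nseq p a ++ nseq q b) = nseq q b ++ nseq p a.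
  move=> ba; apply: (@sorted_eq _ <=%R) => //.
  - exact: le_trans.
  - exact: le_anti.
  - exact: sort_le_sorted.
  - apply/(sortedP 0) => i; rewrite !nth_cat !nth_nseq !size_nseq size_cat !size_nseq.
    move=> ilt; have [iq|qi] := ltnP i.+1 q; first by rewrite (ltnW iq) lexx.
    have ip : (i.+1 - q < p)%N by rewrite ltn_subLR.
    rewrite ip; case: ltnP => // qi'.
    by rewrite (leq_ltn_trans _ ip) // leq_sub2r.
  - by rewrite perm_sort perm_catC.
have sumE (a b : R) : b <= a ->
    \sum_(i < q + p) nth 0 (incr (nseq p a ++ nseq q b)) i = p%:R * a + q%:R * b.
  move=> ba; rewrite incrE // big_split_ord /= addrC; congr (_ + _).
    rewrite (eq_bigr (fun=> a)) ?sumr_const ?card_ord ?mulr_natl // => i _.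
    by rewrite nth_cat size_nseq ltnNge leq_addr /= addKn nth_nseq ltn_ord.
  rewrite (eq_bigr (fun=> b)) ?sumr_const ?card_ord ?mulr_natl // => i _.
  by rewrite nth_cat size_nseq ltn_ord nth_nseq ltn_ord.
split.
  have := H 1%N; rewrite size_cat !size_nseq addn_gt0 q0 orbT => /(_ isT).
  by rewrite !big_ord1 !incrE // !nth_cat !size_nseq q0 !nth_nseq q0.
by have := H (q + p)%N; rewrite size_cat !size_nseq (addnC p) leqnn => /(_ isT); rewrite !sumE.
Qed.

Lemma wsupmaj_total (R : realType) (a1 a2 b1 b2 : R) :
  wsupmaj [:: a1; a2] [:: b1; b2] -> b1 + b2 <= a1 + a2.
Proof.
case=> _ /(_ 0%N isT).
suff sumE c1 c2 : \sum_(0 <= i < 2) nth 0 (incr [:: c1; c2]) i = c1 + c2 :> R.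
  by rewrite /= !sumE.
transitivity (\sum_(c <- incr [:: c1; c2]) c).
  by rewrite [RHS](big_nth 0) /incr size_sort.
rewrite (perm_big [:: c1; c2]) /=; last by rewrite /incr perm_sort.
by rewrite !big_cons big_nil addr0.
Qed.

(** * Law of the maximum *)

Section MaxProbability.
Variables (R : realType) (d : measure_display) (T : measurableType d).
Variables (P : probability T R) (n : nat) (Z : 'I_n -> {RV P >-> R}).
Hypothesis Z0 : forall i w, 0 <= Z i w.

Lemma measurable_all_le x : measurable [set w | forall i, Z i w <= x].
Proof.
rewrite (_ : mkset _ = \bigcap_(i in [set: 'I_n]) (Z i @^-1` `]-oo, x])).
  apply: fin_bigcap_measurable => // i _.
  by rewrite -[X in measurable X]setTI; apply: measurable_funP.
apply/seteqP; split => w /=; first by move=> h i _ /=; rewrite in_itv /= h.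
by move=> h i; have := h i Logic.I; rewrite /= in_itv.
Qed.

Lemma prob_max_gt_neg x : x < 0 -> P [set w | x < max_rv Z w] = 1%E.
Proof.
move=> x0; rewrite (_ : mkset _ = setT) ?probability_setT //.
apply/seteqP; split => // w _ /=; apply: lt_le_trans x0 _.
exact: bigmax_ge_id.
Qed.

(** For [x >= 0] the initial value 0 of the iterated maximum does not exceed [x], so only the [Z i]
    decide. *)
Lemma prob_max_gt x : 0 <= x ->
  (P [set w | (x < max_rv Z w)%R] = 1 - P [set w | forall i, (Z i w <= x)%R])%E.
Proof.
move=> x0; rewrite -probability_setC; last exact: measurable_all_le.
congr (P _); apply/seteqP; split => w /=.
  move=> lt h; move: lt; rewrite ltNge => /negP; apply.
  by apply/bigmax_leP; split.
move=> h; rewrite ltNge; apply/negP => /bigmax_leP[_ h']; apply: h => i.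
exact: h'.
Qed.

End MaxProbability.

Lemma sum_two_marg (R : realType) (k1 k2 : nat) (F1 F2 h : R -> R) (l1 l2 x : R) :
  \sum_(i < k1 + k2) h (two_marg k1 F1 F2 l1 l2 i x)
    = k1%:R * h (F1 (l1 * x)) + k2%:R * h (F2 (l2 * x)).
Proof.
rewrite big_split_ord /=; congr (_ + _).
  rewrite (eq_bigr (fun=> h (F1 (l1 * x)))) ?sumr_const ?card_ord ?mulr_natl //.
  by move=> i _; rewrite /two_marg /= ltn_ord.
rewrite (eq_bigr (fun=> h (F2 (l2 * x)))) ?sumr_const ?card_ord ?mulr_natl //.
by move=> i _; rewrite /two_marg /= ltnNge leq_addr.
Qed.

Lemma arch_copula_all_le (R : realType) (d : measure_display)
    (T : measurableType d) (P : probability T R) (n : nat)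
    (Z : 'I_n -> {RV P >-> R}) (G : 'I_n -> R -> R) (psi : R -> R) (x : R) :
  shares_arch_copula Z G psi -> (forall i, 0 < G i x <= 1) ->
  P [set w | forall i, Z i w <= x] = (psi (\sum_(i < n) phi psi (G i x)))%:E.
Proof.
move=> [g [_ ->]] GI; rewrite (eq_bigr (fun i => (phi psi (G i x))%:E)) ?sumEFin //.
by move=> i _; rewrite (gen_invE _ _ _ g).
Qed.

(** * Change of block sizes and scales under one generator *)

Lemma two_block_maxima_order (R : realType) (n1 n2 p q k : nat)
    (F1 f1 F2 f2 psi : R -> R) (l1 l2 m1 m2 x : R) (m : R -> R) :
  is_generator k psi -> log_convex_on `[0, +oo[ psi ->
  baseline_cdf F1 f1 -> baseline_cdf F2 f2 -> rev_hazards_separated R F1 f1 F2 f2 m ->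
  (0 < p)%N -> (0 < q)%N -> (n1 <= p)%N -> (q <= n2)%N ->
  p%:R + q%:R <= n1%:R + n2%:R :> R ->
  0 < l2 <= l1 -> 0 < m2 <= m1 -> l2 <= m2 ->
  p%:R * l1 + q%:R * l2 <= p%:R * m1 + q%:R * m2 -> 0 < x ->
  psi (n1%:R * phi psi (F1 (l1 * x)) + n2%:R * phi psi (F2 (l2 * x)))
    <= psi (p%:R * phi psi (F1 (m1 * x)) + q%:R * phi psi (F2 (m2 * x))).
Proof.
move=> gpsi lc bF1 bF2 sep p0 q0 n1p qn2 tot /andP[l20 l21] /andP[m20 m21] lm2 wsum x0.
have [hom1 _] := bF1; have [hom2 _] := bF2.
have [dec r F1pos F2pos] := sep.
pose L1 := l1 * x; pose L2 := l2 * x; pose M1 := m1 * x; pose M2 := m2 * x.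
have L2_0 : 0 < L2 by rewrite mulr_gt0.
have M2_0 : 0 < M2 by rewrite mulr_gt0.
have L21 : L2 <= L1 by rewrite ler_pM2r.
have M21 : M2 <= M1 by rewrite ler_pM2r.
have LM2 : L2 <= M2 by rewrite ler_pM2r.
have Wsum : p%:R * L1 + q%:R * L2 <= p%:R * M1 + q%:R * M2.
  by rewrite /L1 /L2 /M1 /M2 !mulrA -!mulrDl ler_pM2r.
rewrite -/L1 -/L2 -/M1 -/M2.
have L1_0 : 0 < L1 by lra.
have M1_0 : 0 < M1 by lra.
have I1 t : 0 < t -> 0 < F1 t <= 1.
  by move=> t0; rewrite F1pos // (baseline_le1 _ _ _ bF1).
have I2 t : 0 < t -> 0 < F2 t <= 1.
  by move=> t0; rewrite F2pos // (baseline_le1 _ _ _ bF2).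
have le1 := fun t => baseline_le1 _ _ _ bF1 t.
have le2 := fun t => baseline_le1 _ _ _ bF2 t.
have order t : 0 < t -> F2 t <= F1 t.
  by move=> t0; apply: (baseline_order _ _ _ _ _ bF1 bF2 m).
have nn1 t : 0 < t -> 0 <= phi psi (F1 t) by move=> /I1; apply: phi_ge0 gpsi _.
have nn2 t : 0 < t -> 0 <= phi psi (F2 t) by move=> /I2; apply: phi_ge0 gpsi _.
apply: (generator_nonincr _ _ _ gpsi).
  by rewrite addr_ge0 // mulr_ge0 ?ler0n ?nn1 ?nn2.
have pR : 0 < p%:R :> R by rewrite ltr0n.
have qR : 0 < q%:R :> R by rewrite ltr0n.
(* The intermediate term has the new block sizes but the old scales. *)
apply: (@le_trans _ _ (p%:R * phi psi (F1 L1) + q%:R * phi psi (F2 L2))); last first.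
  have ph : phi psi (F1 L1) <= phi psi (F2 L2).
    apply: (phi_nonincr _ _ _ gpsi) => //; first exact: F2pos.
    by apply: (le_trans (order _ L2_0)); apply: hom1.
  have qn2R : q%:R <= n2%:R :> R by rewrite ler_nat.
  have := nn1 _ L1_0.
  (* The [p - n1] extra terms of the first block are moved to the second, where each is larger; by
     [tot] they number at most [n2 - q]. *)
  have : (p%:R - n1%:R) * phi psi (F1 L1) <= (p%:R - n1%:R) * phi psi (F2 L2).
    by rewrite ler_wpM2l // subr_ge0 ler_nat.
  have : (p%:R - n1%:R) * phi psi (F2 L2) <= (n2%:R - q%:R) * phi psi (F2 L2).
    by rewrite ler_wpM2r ?nn2 //; lra.
  lra.
(* If [L1 <= M1], both arguments grow and the comparison is termwise. Otherwise
   [L2 <= M2 <= M1 < L1]. *)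
have [LM1|ML1] := leP L1 M1.
  apply: lerD; rewrite ler_wpM2l ?ler0n //; apply: (phi_nonincr _ _ _ gpsi) => //.
  - exact: F1pos.
  - exact: hom1.
  - exact: F2pos.
  - exact: hom2.
apply: (phi_weighted_sum_le _ _ _ gpsi lc) => //.
- exact: F2pos.
- exact: hom2.
- by apply: (le_trans (order _ M2_0)); apply: hom1.
- by apply: hom1; apply: ltW.
have g1 : ln (F1 L1) - ln (F1 M1) <= m M1 * (L1 - M1).
  apply: (ln_baseline_le _ _ _ bF1); [exact: ltW|exact: ltW|exact: F1pos| |].
    exact: (separator_ge0 _ _ _ _ _ bF1 _ sep _ M1_0).
  move=> t Mt _; have t0 := lt_trans M1_0 Mt.
  have /andP[h _] := r _ t0; apply: (le_trans h).
  by apply: dec; rewrite ?posrE // ltW.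
have g2 : m M2 * (M2 - L2) <= ln (F2 M2) - ln (F2 L2).
  apply: (ln_baseline_ge _ _ _ bF2) => //; [exact: ltW|exact: F2pos| |].
    exact: (separator_ge0 _ _ _ _ _ bF1 _ sep _ M2_0).
  move=> t Lt tM; have t0 := lt_trans L2_0 Lt.
  have /andP[_ h] := r _ t0; apply: le_trans h.
  by apply: dec; rewrite ?posrE.
have mM : m M1 <= m M2 by apply: dec; rewrite ?posrE.
have mM0 : 0 <= m M1 := separator_ge0 _ _ _ _ _ bF1 _ sep _ M1_0.
apply: (le_trans (ler_wpM2l (ltW pR) g1)).
apply: le_trans (ler_wpM2l (ltW qR) g2).
(* [Wsum] reads [p (L1 - M1) <= q (M2 - L2)]; it is scaled by [m M1], which is then raised to
   [m M2]. *)
apply: (@le_trans _ _ (m M1 * (q%:R * (M2 - L2)))).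
  by rewrite mulrCA ler_wpM2l //; lra.
rewrite mulrCA ler_wpM2l ?ler0n // ler_wpM2r // subr_ge0 //.
Qed.

(** * Stochastic order of the two maxima *)

Theorem theorem3p3 (R : realType)
  (n1 n2 ns1 ns2 : nat)
  (F1 F2 f1 f2 : R -> R) (psi1 psi2 : R -> R)
  (lam1 lam2 mu1 mu2 : R)
  (d1 : measure_display) (T1 : measurableType d1) (P1 : probability T1 R)
  (X : 'I_(n1 + n2) -> {RV P1 >-> R})
  (d2 : measure_display) (T2 : measurableType d2) (P2 : probability T2 R)
  (Y : 'I_(ns1 + ns2) -> {RV P2 >-> R}) :
  (1 <= n1)%N -> (n1 <= ns1)%N -> (ns1 <= ns2)%N -> (ns2 <= n2)%N ->
  baseline_cdf F1 f1 -> baseline_cdf F2 f2 ->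
  (forall i w, 0 <= X i w) ->
  shares_arch_copula X (two_marg n1 F1 F2 lam1 lam2) psi1 ->
  (forall i w, 0 <= Y i w) ->
  shares_arch_copula Y (two_marg ns1 F1 F2 mu1 mu2) psi2 ->
  (forall x, 0 < x -> f1 x / F1 x <= f2 x / F2 x) ->
  wsupmaj [:: n1%:R : R; n2%:R] [:: ns1%:R; ns2%:R] ->
  0 < lam2 <= lam1 -> 0 < mu2 <= mu1 ->
  superadditive_on_nonneg (fun x => gen_inv psi2 (psi1 x)) ->
  (log_convex_on `[0, +oo[ psi1 \/ log_convex_on `[0, +oo[ psi2) ->
  (nonincr_on `]0, +oo[ (fun x => f1 x / F1 x) \/
   nonincr_on `]0, +oo[ (fun x => f2 x / F2 x)) ->
  wsubmaj (nseq ns1 lam1 ++ nseq ns2 lam2) (nseq ns1 mu1 ++ nseq ns2 mu2) ->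
  forall x : R,
    (P2 [set w | (x < max_rv Y w)%R] <= P1 [set w | (x < max_rv X w)%R])%E.
Proof.
move=> n1_gt0 n1ns1 ns12 ns2n2 bF1 bF2 X0 cX Y0 cY r12 maj_n lam mu sup lc dec maj_lm x.
have [x_lt0|x_ge0] := ltP x 0; first by rewrite !prob_max_gt_neg.
rewrite !prob_max_gt //; apply: leeB => //.
have ns1_gt0 : (0 < ns1)%N := leq_trans n1_gt0 n1ns1.
have ns2_gt0 : (0 < ns2)%N := leq_trans ns1_gt0 ns12.
have [lm2 wsum] : lam2 <= mu2 /\
    ns1%:R * lam1 + ns2%:R * lam2 <= ns1%:R * mu1 + ns2%:R * mu2.
  by apply: wsubmaj_blocks maj_lm; [|case/andP: lam|case/andP: mu].
have tot := wsupmaj_total _ _ _ _ _ maj_n.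
(* At [x = 0] the margins vanish and [phi] is not usable; there the joint event for [X] lies in
   [X i0 <= 0], which has probability 0. *)
move: x_ge0; rewrite le_eqVlt => /predU1P[<-|x0].
  have i0 : 'I_(n1 + n2) by apply: (@Ordinal _ 0); rewrite addn_gt0 n1_gt0.
  apply: (@le_trans _ _ 0%E) => //.
  have -> : 0%E = P1 [set w | X i0 w <= 0].
    case: cX => _ [-> _]; rewrite /two_marg !mulr0 (baseline_at0 _ _ _ bF1).
    by rewrite (baseline_at0 _ _ _ bF2) if_same.
  apply: le_measure; rewrite ?inE; [exact: measurable_all_le| |by move=> w /=].
  rewrite (_ : mkset _ = X i0 @^-1` `]-oo, 0]).
    by rewrite -[X in measurable X]setTI; apply: measurable_funP.
  by apply/seteqP; split => w /=; rewrite in_itv.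
have [m sep] := ex_rev_hazards_separated _ _ _ _ _ bF1 bF2 r12 dec.
have [_ _ F1pos F2pos] := sep.
have margI k1 k (l1 l2 : R) : 0 < l2 <= l1 ->
    forall i : 'I_k, 0 < two_marg k1 F1 F2 l1 l2 i x <= 1.
  move=> /andP[l20 l21] i; rewrite /two_marg; case: ifP => _.
    by rewrite F1pos ?(baseline_le1 _ _ _ bF1) // mulr_gt0 // (lt_le_trans l20).
  by rewrite F2pos ?(baseline_le1 _ _ _ bF2) // mulr_gt0.
rewrite (arch_copula_all_le _ _ _ _ _ _ _ _ _ cX (margI _ _ _ _ lam)).
rewrite (arch_copula_all_le _ _ _ _ _ _ _ _ _ cY (margI _ _ _ _ mu)) lee_fin.
have [gX _] := cX; have [gY _] := cY.
(* The log-convex generator carries the change of parameters: the generators are exchanged at the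
   margins of [Y] if it is [psi1], and at those of [X] if it is [psi2]. *)
case: lc => lc.
- apply: le_trans (arch_copula_order _ _ _ _ _ _ _ gX gY sup (margI _ _ _ _ mu)).
  rewrite !(sum_two_marg _ _ _ _ _ (phi psi1)).
  by apply: (two_block_maxima_order _ _ _ _ _ _ _ _ _ _ _ _ _ _ _ _ _ gX lc bF1 bF2 sep).
- apply: (le_trans (arch_copula_order _ _ _ _ _ _ _ gX gY sup (margI _ _ _ _ lam))).
  rewrite !(sum_two_marg _ _ _ _ _ (phi psi2)).
  by apply: (two_block_maxima_order _ _ _ _ _ _ _ _ _ _ _ _ _ _ _ _ _ gY lc bF1 bF2 sep).
Qed.
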